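(* Let $r,s\in\mathbb{N}$ with $r<s$ and $\mathcal{A}=\{r,s\}$. Define $\mu$ on cylinder sets $[w]=\{z\in\mathcal{A}^{\mathbb{N}}: z_1=w_1,\ldots,z_n=w_n\}$ of nonempty words $w=w_1\ldots w_n$ by $$\mu([w])=\begin{cases}\mu([D^j(w)])\cdot (r+s)^{-j} & \text{if } w \text{ is a } C^{\infty}\text{-word of degree } j,\\ 0 & \text{if } w \text{ is not a } C^{\infty}\text{-word},\end{cases}$$ where the values of $\mu$ on cylinders of fundamental words are fixed by requiring $\mu([w])=\mu([\tilde{w}])$ and $\mu([w])=\mu([\overleftarrow{w}])$ for all fundamental words $w$, and $\sum_{w\in\mathcal{A}^n}\mu([w])=1$ for all $1\le n<\max\{s,2r+1\}$. Then $\mu$ extends to a Borel measure on $\mathcal{A}^{\mathbb{N}}$, and this measure is mirror invariant ($\mu([w])=\mu([\tilde w])$ for all words $w$), reversal invariant ($\mu([w])=\mu([\overleftarrow{w}])$ for all words $w$) and shift invariant.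
   Context: A run in a word is a maximal subword of identical letters. For $w=w_1\ldots w_n$: $\tilde{w}=\tilde{w}_1\ldots\tilde{w}_n$ with $\tilde r=s,\tilde s=r$, and $\overleftarrow{w}=w_n\ldots w_1$. Derivative: $D(\varepsilon)=\varepsilon$; if $w$ is a single run of length less than $s$, $D(w)=\varepsilon$; otherwise alter $w$ by deleting its first (resp. last) run if that run has length at most $r$ and extending it to a run of length exactly $s$ if its length is between $r+1$ and $s$; $D(w)$ is the sequence of run lengths of the altered word. A word $w$ is a $C^{\infty}$-word if $D^k(w)$ is a word over $\{r,s\}$ (possibly empty) for all $k\ge0$. A nonempty $C^{\infty}$-word $w$ has degree $j\ge 0$ if $D^j(w)\neq\varepsilon$ and $D^{j+1}(w)=\varepsilon$; $C^{\infty}$-words of degree $0$ (nonempty words with $D(w)=\varepsilon$) are called fundamental words. (E.g. over $\{1,2\}$ this gives $\mu([1])=\mu([2])=\tfrac12$, $\mu([12])=\mu([21])=\tfrac13$.)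
   Formalization: The stated requirements do not always fix the values on fundamental words (r=1, s=3 leaves μ([11]) free), so it is proved that some μ meeting them extends to a Borel measure with the three invariances, and that it is the only μ meeting them that extends to a Borel measure. *)

(* Defs.v *)
From HB Require Import structures.
From mathcomp Require Import all_boot all_order all_algebra.
From mathcomp Require Import all_classical all_reals all_analysis.

Set Implicit Arguments.
Unset Strict Implicit.
Unset Printing Implicit Defensive.

Import Order.TTheory GRing.Theory Num.Theory.

Local Open Scope classical_set_scope.
Local Open Scope ring_scope.

(* Finite words are sequences of natural numbers, because the derivative of a
   word over {r, s} need not be a word over {r, s}. *)
Definition word_over (r s : nat) (w : seq nat) : bool :=
  all (fun x => x \in [:: r; s]) w.

Definition mirror (r s : nat) (w : seq nat) : seq nat :=
  [seq if x == r then s else r | x <- w].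

(* [incr_nth l 0] increments the head of [l]. *)
Fixpoint run_lengths (w : seq nat) : seq nat :=
  if w is x :: w' then
    if w' is y :: _ then
      if x == y then incr_nth (run_lengths w') 0 else 1%N :: run_lengths w'
    else [:: 1%N]
  else [::].

(* What becomes of a first or last run of length [l], as a list of run lengths:
   deleted, extended to length [s], or (when [s < l]) left unchanged. *)
Definition end_run (r s l : nat) : seq nat :=
  if (l <= r)%N then [::] else if (l <= s)%N then [:: s] else [:: l].

(* The alteration only affects the end runs, so it is carried out directly on
   the run lengths.  Since [l' :: ls] is [rcons (belast l' ls) (last l' ls)],
   [belast l' ls] lists the lengths of the inner runs. *)
Definition derivative (r s : nat) (w : seq nat) : seq nat :=
  match run_lengths w with
  | [::] => [::]
  | [:: l] => if (l < s)%N then [::] else end_run r s l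
  | l :: l' :: ls =>
      end_run r s l ++ belast l' ls ++ end_run r s (last l' ls)
  end.

Definition Cinfty (r s : nat) (w : seq nat) : Prop :=
  forall k, word_over r s (iter k (derivative r s) w).

Definition has_degree (r s : nat) (w : seq nat) (j : nat) : Prop :=
  [/\ w != [::], Cinfty r s w, iter j (derivative r s) w != [::]
    & iter j.+1 (derivative r s) w = [::]].

Definition fundamental (r s : nat) (w : seq nat) : Prop := has_degree r s w 0.

Definition letter (r s : nat) : Type := seq_sub [:: r; s].
HB.instance Definition _ (r s : nat) := Finite.on (letter r s).
HB.instance Definition _ (r s : nat) :=
  isPointed.Build (letter r s) (SeqSub (mem_head r [:: s])).

(* The space of infinite words, with the product of the discrete topologies. *)
Definition infword (r s : nat) : Type :=
  prod_topology (fun _ : nat => discrete_topology (letter r s)).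
HB.instance Definition _ (r s : nat) := Pointed.on (infword r s).
HB.instance Definition _ (r s : nat) := Nbhs.on (infword r s).
HB.instance Definition _ (r s : nat) := Topological.on (infword r s).

Definition borel_infword (r s : nat) :=
  g_sigma_algebraType (@open (infword r s)).

Definition cylinder (r s : nat) (w : seq nat) : set (borel_infword r s) :=
  [set z | forall i, (i < size w)%N -> val (z i) = nth 0%N w i].
Arguments cylinder r s w : clear implicits.

Definition shift_infword (r s : nat) (z : borel_infword r s) : borel_infword r s :=
  fun n => z n.+1.
Arguments shift_infword r s z : clear implicits.

(* The requirements on the values [mu w], standing for the measure of the
   cylinder of [w]; [mu] is only constrained on nonempty words over {r, s}.
   For [j = 0] the formula says nothing: the values on fundamental words are
   subject to the last three requirements only.  These do not always determine
   them: for r = 1 and s = 3 they only give mu(1) = mu(3) = 1/2 and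
   mu(11) + mu(13) = 1/2, whereas additivity forces mu(11) = 1/4. *)
Record cylinder_values (R : realType) (r s : nat) (mu : seq nat -> R) : Prop := {
  cylinder_values_degree : forall w j, has_degree r s w j ->
    mu w = mu (iter j (derivative r s) w) * (r + s)%:R ^- j ;
  cylinder_values_nCinfty : forall w, word_over r s w -> w != [::] ->
    ~ Cinfty r s w -> mu w = 0 ;
  cylinder_values_mirror : forall w, fundamental r s w ->
    mu w = mu (mirror r s w) ;
  cylinder_values_rev : forall w, fundamental r s w -> mu w = mu (rev w) ;
  cylinder_values_sum : forall n, (1 <= n < maxn s (2 * r + 1))%N ->
    \sum_(t : n.-tuple (letter r s)) mu [seq val x | x <- t] = 1 }.

Definition extends (R : realType) (r s : nat) (mu : seq nat -> R)
    (P : {measure set (borel_infword r s) -> \bar R}) : Prop :=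
  forall w, word_over r s w -> w != [::] -> P (cylinder r s w) = (mu w)%:E.

Definition mirror_invariant (R : realType) (r s : nat)
    (P : {measure set (borel_infword r s) -> \bar R}) : Prop :=
  forall w, word_over r s w ->
    P (cylinder r s w) = P (cylinder r s (mirror r s w)).

Definition reversal_invariant (R : realType) (r s : nat)
    (P : {measure set (borel_infword r s) -> \bar R}) : Prop :=
  forall w, word_over r s w -> P (cylinder r s w) = P (cylinder r s (rev w)).

Definition shift_invariant (R : realType) (r s : nat)
    (P : {measure set (borel_infword r s) -> \bar R}) : Prop :=
  forall B : set (borel_infword r s), measurable B ->
    P (shift_infword r s @^-1` B) = P B.

(* Main.v *)
(* The weight of w is the frequency expected in a random word whose sequence of
   run lengths has the same law as the word itself: a run has mean length
   (r + s) / 2 and its letter is equidistributed, so w occurs with frequency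
   mu (D w) / (r + s), where the empty word has weight 1, except that a single
   run of length l < s may sit at several places of a longer run and occurs with
   frequency ((r + 1 - l)^+ + (s + 1 - l)^+) / (2 (r + s)).
   Prepending a letter to w either lengthens the first run or completes it,
   which changes D w at its first letter only; mu w = mu (r w) + mu (s w) then
   follows by induction on the length, and the reversal symmetry of D gives
   mu w = mu (w r) + mu (w s).  The latter is compatibility on cylinders, the
   former shift invariance.

   No compactness is needed for the extension: splitting [0, 1[ successively
   into intervals of lengths mu w codes a real number by an infinite word, and
   the measure is the image of Lebesgue measure.

   For uniqueness, additivity to the right propagates the values from words with
   a nonempty derivative down to the fundamental words a^i b^j (by decreasing j)
   and then a^l (by decreasing l). *)
Require Import Defs.
From HB Require Import structures.
From mathcomp Require Import all_boot all_order all_algebra.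
From mathcomp Require Import zify ring lra.
From mathcomp Require Import all_classical all_reals all_analysis.

Import Order.TTheory GRing.Theory Num.Theory.
Local Open Scope classical_set_scope.
Local Open Scope ring_scope.

(** * Run lengths, also of a reversed word *)

Lemma run_lengths_nil (w : seq nat) : (run_lengths w == [::]) = (w == [::]).
Proof.
elim: w => [|x [|y w] IH] //=; case: ifP => // _.
by case: (if _ is _ :: _ then _ else _).
Qed.

Lemma run_lengths_cons (x : nat) (w : seq nat) :
  run_lengths (x :: w) =
  if w is y :: _ then
    if x == y then incr_nth (run_lengths w) 0 else 1%N :: run_lengths w
  else [:: 1%N].
Proof. by []. Qed.

Lemma run_lengths_gt0 (w : seq nat) : all (leq 1) (run_lengths w).
Proof.
elim: w => [|x [|y w] IH] //; rewrite run_lengths_cons.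
case: ifP => _; last by rewrite /= IH.
by case: (run_lengths (y :: w)) IH => [|l T] //= /andP[].
Qed.

Lemma size_run_lengths (w : seq nat) : (size (run_lengths w) <= size w)%N.
Proof.
elim: w => [|x [|y w] IH] //; rewrite run_lengths_cons.
case: ifP => _ //; rewrite size_incr_nth.
case: ifP => _ //=; exact: (leq_trans IH).
Qed.

Lemma run_lengths_cat (u v : seq nat) (a b : nat) : a != b ->
  run_lengths (rcons u a ++ b :: v) =
  run_lengths (rcons u a) ++ run_lengths (b :: v).
Proof.
move=> ab; elim: u => [|x u IH]; first by rewrite /= (negPf ab).
rewrite rcons_cons cat_cons !run_lengths_cons IH.
case: u {IH} => [|y u] /=; first by case: ifP.
case: ifP => // _.
have : run_lengths (y :: rcons u a) != [::] by rewrite run_lengths_nil.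
by rewrite /=; case: (match _ with [::] => _ | _ => _ end).
Qed.

Lemma run_lengths_nseq (n x : nat) : run_lengths (nseq n.+1 x) = [:: n.+1].
Proof.
elim: n => // n IH; rewrite -[nseq n.+2 x]/(x :: nseq n.+1 x).
by rewrite run_lengths_cons IH /= eqxx.
Qed.

(** Peeling off the whole first run replaces induction on letters by induction on runs, which
    reversal requires. *)
Lemma first_runP (x : nat) (w : seq nat) : exists n v,
  x :: w = nseq n.+1 x ++ v /\ (v = [::] \/ exists y v', v = y :: v' /\ x != y).
Proof.
elim: w x => [|y w IH] x; first by exists 0%N, [::]; split; [|left].
have [->|xy] := eqVneq x y.
  have [n [v [-> vP]]] := IH y.
  by exists n.+1, v.
by exists 0%N, (y :: w); split => //; right; exists y, w.
Qed.

Lemma run_lengths_rev (w : seq nat) :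
  run_lengths (rev w) = rev (run_lengths w).
Proof.
have [k] := ubnP (size w); elim: k w => // k IH [|x w] wk //.
have [n [v [E vP]]] := first_runP x w.
rewrite E; case: vP => [->|[y [v' [vE xy]]]].
  by rewrite cats0 rev_nseq run_lengths_nseq.
have vk : (size v < k)%N.
  by move: (congr1 size E) wk; rewrite size_cat size_nseq /=; lia.
(* [run_lengths_cat] asks for a left factor of the form [rcons u a]. *)
have rnc : nseq n.+1 x = rcons (nseq n x) x by elim: n {E} => //= n ->.
rewrite rev_cat rev_nseq {1}vE rev_cons [nseq n.+1 x]/= run_lengths_cat
  1?eq_sym //.
rewrite -rev_cons -vE IH // -[x :: nseq n x]/(nseq n.+1 x) rnc.
by rewrite vE run_lengths_cat // rev_cat -vE -rnc run_lengths_nseq.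
Qed.

(** * The derivative as a function of the run lengths: symmetries and loss of length *)

Definition derivative_of_runs (r s : nat) (L : seq nat) : seq nat :=
  match L with
  | [::] => [::]
  | [:: l] => if (l < s)%N then [::] else end_run r s l
  | l :: l' :: ls =>
      end_run r s l ++ belast l' ls ++ end_run r s (last l' ls)
  end.

Lemma derivativeE (r s : nat) (w : seq nat) :
  derivative r s w = derivative_of_runs r s (run_lengths w).
Proof. by []. Qed.

(** For two or more runs, this form displays the left-right symmetry and separates the inner runs
    [L] from the end runs. *)
Lemma derivative_of_runs_rcons (r s l l' : nat) (L : seq nat) :
  derivative_of_runs r s (l :: rcons L l') =
  end_run r s l ++ L ++ end_run r s l'.
Proof. by case: L => [|x L] //=; rewrite belast_rcons last_rcons. Qed.

Lemma end_run_rev (r s l : nat) : rev (end_run r s l) = end_run r s l.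
Proof. by rewrite /end_run; case: ifP => // _; case: ifP. Qed.

Lemma derivative_of_runs_rev (r s : nat) (L : seq nat) :
  derivative_of_runs r s (rev L) = rev (derivative_of_runs r s L).
Proof.
case: L => // l L; case/lastP: L => [|L l'].
  by rewrite /=; case: ifP => // _; rewrite end_run_rev.
rewrite rev_cons rev_rcons rcons_cons !derivative_of_runs_rcons.
by rewrite !rev_cat !end_run_rev catA.
Qed.

Lemma derivative_rev (r s : nat) (w : seq nat) :
  derivative r s (rev w) = rev (derivative r s w).
Proof. by rewrite !derivativeE run_lengths_rev derivative_of_runs_rev. Qed.

Lemma word_over_rev (r s : nat) (w : seq nat) :
  word_over r s (rev w) = word_over r s w.
Proof. exact: all_rev. Qed.

Lemma word_over_mirror (r s : nat) (w : seq nat) : word_over r s (mirror r s w).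
Proof.
apply/allP => _ /mapP[x _ ->]; rewrite !inE.
by case: ifP; rewrite eqxx ?orbT.
Qed.

(** On [{r, s}] the mirror is injective, so it preserves equality and inequality of neighbours; it
    would send any foreign letter to [r]. *)
Lemma run_lengths_mirror (r s : nat) (w : seq nat) : r != s ->
  word_over r s w -> run_lengths (mirror r s w) = run_lengths w.
Proof.
move=> rs; elim: w => [|x [|y w] IH] // /andP[xA wA].
rewrite [LHS]run_lengths_cons IH // run_lengths_cons;
  congr (if _ then _ else _).
have sr : (s == r) = false by rewrite eq_sym (negPf rs).
case/andP: wA => yA _; move: xA yA; rewrite !inE.
by move=> /orP[]/eqP-> /orP[]/eqP->; rewrite ?eqxx ?sr ?(negPf rs) ?eqxx ?sr.
Qed.

Lemma sumn_run_lengths (w : seq nat) : sumn (run_lengths w) = size w.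
Proof.
elim: w => [|x [|y w] IH] //; rewrite run_lengths_cons.
rewrite -[size (x :: y :: w)]/(size (y :: w)).+1 -IH.
by case: ifP => _ //; case: (run_lengths (y :: w)).
Qed.

(** A run of length 1 is deleted because [r > 0]; a longer one contributes at most one letter. *)
Lemma size_end_run (r s l : nat) : (0 < r)%N -> (0 < l)%N ->
  (size (end_run r s l) < l)%N.
Proof.
by move=> r0 l0; rewrite /end_run; do 2?case: ifP => //=; lia.
Qed.

(** An inner run, of length at least 1, contributes one letter, and an end run fewer letters than
    its length. This makes recursion and induction along [D] terminate. *)
Lemma size_derivative (r s : nat) (w : seq nat) : (0 < r)%N -> w != [::] ->
  (size (derivative r s w) < size w)%N.
Proof.
move=> r0; rewrite derivativeE -run_lengths_nil -(sumn_run_lengths w).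
have := run_lengths_gt0 w; case: (run_lengths w) => // l L.
case/lastP: L => [|L l'].
  move=> /andP[l0 _] _ /=.
  case: ifP => _; last by move: (size_end_run r s l r0 l0); lia.
    by rewrite /=; lia.
rewrite derivative_of_runs_rcons !size_cat /= all_rcons sumn_rcons.
move=> /and3P[l0 l'0 L0] _.
have {L0} : (size L <= sumn L)%N.
  by elim: L L0 => //= n L IH /andP[n0 /IH]; lia.
by move: (size_end_run r s l r0 l0) (size_end_run r s l' r0 l'0); lia.
Qed.

(** * The explicit weight and its additivity on both sides *)

Section Values.
Variables (R : realType) (r s : nat).

(* The truncated subtraction is intended: a run of length r contains no run of
   length l > r. *)
Definition run_weight (l : nat) : R :=
  ((r.+1 - l) + (s.+1 - l))%:R / (2 * (r + s)%:R).

(* n is fuel, sufficient when size w < n because D shortens words. *)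
Fixpoint weight_rec (n : nat) (w : seq nat) : R :=
  if n is m.+1 then
    if ~~ word_over r s w then 0 else
    match run_lengths w with
    | [::] => 1
    | [:: l] =>
        if (l < s)%N then run_weight l
        else weight_rec m (derivative r s w) / (r + s)%:R
    | _ => weight_rec m (derivative r s w) / (r + s)%:R
    end
  else 0.

Definition weight (w : seq nat) : R := weight_rec (size w).+1 w.

(** One unfolding of the recursion, free of fuel: on words over [{r, s}] the weight depends on the
    run lengths alone. *)
Definition weight_of_runs (L : seq nat) : R :=
  match L with
  | [::] => 1
  | [:: l] =>
      if (l < s)%N then run_weight l
      else weight (derivative_of_runs r s L) / (r + s)%:R
  | _ => weight (derivative_of_runs r s L) / (r + s)%:R
  end.

Hypotheses (r_gt0 : (0 < r)%N) (lt_rs : (r < s)%N).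

Lemma weight_rec_fuel (n m : nat) (w : seq nat) :
  (size w < n)%N -> (size w < m)%N -> weight_rec n w = weight_rec m w.
Proof.
elim: n m w => // n IH [//|m] w wn wm /=; case: ifP => // _.
have := run_lengths_nil w.
case: (run_lengths w) => // l L /esym/negbT wn0.
have dw := size_derivative r s w r_gt0 wn0.
rewrite (IH m) //; [exact: leq_trans dw _ | exact: leq_trans dw _].
Qed.

Lemma weightE (w : seq nat) :
  weight w = if word_over r s w then weight_of_runs (run_lengths w) else 0.
Proof.
rewrite /weight /=; case: (word_over r s w) => //=.
have := run_lengths_nil w; have := derivativeE r s w.
case: (run_lengths w) => // l L dE /esym/negbT wn0.
rewrite /weight_of_runs -dE /weight.
have dw := size_derivative r s w r_gt0 wn0.
by rewrite (weight_rec_fuel (size w) (size (derivative r s w)).+1).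
Qed.

Lemma weight_nword (w : seq nat) : ~~ word_over r s w -> weight w = 0.
Proof. by rewrite weightE => /negPf->. Qed.

Lemma weight_nil : weight [::] = 1.
Proof. by rewrite weightE. Qed.

Lemma weight_derivative (w : seq nat) : word_over r s w ->
  derivative r s w != [::] ->
  weight w = weight (derivative r s w) / (r + s)%:R.
Proof.
rewrite derivativeE (weightE w) => ->.
case: (run_lengths w) => [|l [|l' L]] //=; by case: ifP.
Qed.

Lemma weight_ge0 (w : seq nat) : 0 <= weight w.
Proof.
rewrite /weight; move: (size w).+1 => n; elim: n w => //= n IH w;
  case: ifP => // _.
have fin v : 0 <= weight_rec n v / (r + s)%:R by rewrite divr_ge0.
case: (run_lengths w) => // l [|//]; case: ifP => // _.
by rewrite /run_weight divr_ge0 // mulr_ge0.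
Qed.

Lemma weight_mirror (w : seq nat) : word_over r s w ->
  weight (mirror r s w) = weight w.
Proof.
move=> wA; rewrite !weightE wA word_over_mirror run_lengths_mirror //.
by rewrite ltn_eqF.
Qed.

(** Both words have the same length, hence the same fuel, on which the induction runs; [D] commutes
    with reversal. *)
Lemma weight_rev (w : seq nat) : weight (rev w) = weight w.
Proof.
rewrite /weight size_rev; move: (size w).+1 => n; elim: n w => //= n IH w.
rewrite word_over_rev run_lengths_rev derivative_rev IH.
case: ifP => // _; case: (run_lengths w) => // l [|l' L] //.
rewrite !rev_cons; case: (rev L) => [|? [|? ?]] //.
Qed.

(** [x] is the first letter of [w] and [y] the other one. The permutation lets a sum over [r] and
    [s] be read as a sum over [x] and [y], whichever letter comes first. *)
Lemma run_lengths_extend (w : seq nat) : word_over r s w -> w != [::] ->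
  exists x y, [/\ perm_eq [:: x; y] [:: r; s],
    run_lengths (x :: w) =
      (head 0%N (run_lengths w)).+1 :: behead (run_lengths w)
    & run_lengths (y :: w) = 1%N :: run_lengths w].
Proof.
case: w => // a w /andP[aA _] _.
have h x : run_lengths (x :: a :: w) = if x == a then
   (head 0%N (run_lengths (a :: w))).+1 :: behead (run_lengths (a :: w))
   else 1%N :: run_lengths (a :: w).
  rewrite run_lengths_cons; case: ifP => // _.
  have := run_lengths_nil (a :: w); by case: (run_lengths (a :: w)).
move: aA; rewrite !inE => /orP[]/eqP aE; rewrite aE in h *.
  exists r, s; split => //; first by rewrite h eqxx.
  by rewrite h gtn_eqF.
exists s, r; split; first exact/permPl/(perm_catC [:: s] [:: r]).
  by rewrite h eqxx.
by rewrite h ltn_eqF.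
Qed.

Let d_gt0 : (0 : R) < (r + s)%:R.
Proof. by rewrite ltr0n; lia. Qed.

Lemma weight_letter (x : nat) : x \in [:: r; s] -> weight [:: x] = 2^-1.
Proof.
move=> xA; rewrite weightE /= xA /=.
have -> : (1 < s)%N by lia.
by rewrite /run_weight !subn1 /= invfM mulrCA mulfV ?mulr1 // gt_eqF.
Qed.

(** [G] is what the runs after the first contribute to the derivative. A prepended run of length 1
    is deleted by [D], and the former first run becomes an inner letter [l]. *)
Lemma weight_of_runs_split (l : nat) (L : seq nat) : (0 < l)%N ->
  let G := if L is l' :: L' then belast l' L' ++ end_run r s (last l' L')
           else [::] in
  weight (r :: G) + weight (s :: G) = weight G ->
  weight_of_runs (l.+1 :: L) + weight_of_runs [:: 1%N, l & L] =
  weight_of_runs (l :: L).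
Proof.
have : (r + s)%:R != 0 :> R by rewrite gt_eqF.
rewrite /weight_of_runs /run_weight; move: (r + s)%:R => d D0.
have end1 : end_run r s 1 = [::] by rewrite /end_run r_gt0.
have nword n v : n != r -> n != s -> weight (n :: v) = 0.
  by move=> nr ns; rewrite weight_nword //= !inE (negPf nr) (negPf ns).
move=> l0; case: L => [_|l' L].
  have ws : weight [:: s] = 2^-1 by rewrite weight_letter ?inE ?eqxx ?orbT.
  rewrite /= end1 /= {1 3}/end_run.
  have [ls|ls] := ltnP l.+1 s.
    have -> : (l < s)%N by lia.
    rewrite /end_run; have -> : (l <= s)%N by lia.
    case: leqP => lr.
      rewrite weight_nil.
      (* Lengthening the run loses one place inside a run of length [r] and one inside a run of
         length [s]; when [r < l] only the latter is lost. *)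
      have -> : (r.+1 - l + (s.+1 - l) = (r.+1 - l.+1 + (s.+1 - l.+1)) + 2)%N
        by lia.
      by rewrite natrD; field; rewrite D0.
    rewrite ws.
    have -> : (r.+1 - l + (s.+1 - l) = (r.+1 - l.+1 + (s.+1 - l.+1)) + 1)%N
      by lia.
    by rewrite natrD; field; rewrite D0.
  have -> : (l.+1 <= r)%N = false by lia.
  have [lsE|lns] := eqVneq l.+1 s.
    have -> : (l < s)%N by lia.
    rewrite ws /end_run; case: leqP => lr.
      rewrite weight_nil.
      (* Here [l <= r < s = l + 1] forces [l = r]: one place in a run of length [r], two in a run of
         length [s]. *)
      have -> : (r.+1 - l + (s.+1 - l) = 3)%N by lia.
      by field; rewrite D0.
    have -> : (l <= s)%N by lia.
    rewrite ws.
    have -> : (r.+1 - l + (s.+1 - l) = 2)%N by lia.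
    by field; rewrite D0.
  have -> : (l < s)%N = false by lia.
  rewrite (nword l.+1) ?mul0r ?add0r //; lia.
(* The three derivatives are [end_run (l + 1) ++ G], [l :: G] and [end_run l ++ G]. Words starting
   outside [{r, s}] weigh 0, which settles every case but [l = r], where the hypothesis on [G] is
   the claim. *)
set G := (belast l' L ++ _) => /= ; rewrite -/G end1 /= => GE.
rewrite -mulrDl; congr (_ / _).
rewrite -/G /end_run.
have [lr|rl|->] := ltngtP l r.
- by rewrite /= nword ?addr0 //; lia.
- have [ls|sl|->] := ltngtP l s.
  + by rewrite /= (@nword l) ?addr0 //; lia.
  + by rewrite /= !nword ?addr0 //; lia.
  + by rewrite /= (@nword s.+1) ?add0r //; lia.
- by rewrite lt_rs /= addrC.
Qed.

Lemma weight_cons (w : seq nat) :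
  weight w = weight (r :: w) + weight (s :: w).
Proof.
have [n] := ubnP (size w); elim: n w => // n IH w wn.
have [->|wn0] := eqVneq w [::].
  rewrite weight_nil !weight_letter ?inE ?eqxx ?orbT //; lra.
have [wA|wA] := boolP (word_over r s w); last first.
  by rewrite !weight_nword ?addr0 //= (negPf wA) andbF.
have [x [y [xy Ex Ey]]] := run_lengths_extend w wA wn0.
have [xA yA] : x \in [:: r; s] /\ y \in [:: r; s].
  by rewrite -!(perm_mem xy) !inE !eqxx orbT.
have -> : weight (r :: w) + weight (s :: w) = weight (x :: w) + weight (y :: w).
  transitivity (\sum_(z <- [:: r; s]) weight (z :: w)).
    by rewrite 2!big_cons big_nil addr0.
  by rewrite -(perm_big _ xy) 2!big_cons big_nil /= addr0.
have cA z : z \in [:: r; s] -> word_over r s (z :: w) by move=> zA; apply/andP.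
rewrite 3!weightE wA !cA // Ex Ey.
have := run_lengths_nil w; have := run_lengths_gt0 w.
have := size_run_lengths w.
case: (run_lengths w) => [_ _|l L Lw /andP[l0 _] _];
  first by rewrite (negPf wn0).
apply/esym/weight_of_runs_split => //.
set G := (X in r :: X).
(* [G] has at most one letter per run after the first, so it is shorter than [w]. *)
have Gn : (size G < n)%N.
  rewrite /G; case: (L) Lw => [|l' L'] /=; first by lia.
  rewrite size_cat size_belast /end_run.
  by do 2?case: ifP => _ /=; lia.
by rewrite -IH.
Qed.

Lemma weight_rcons (w : seq nat) :
  weight w = weight (rcons w r) + weight (rcons w s).
Proof.
rewrite -(weight_rev w) weight_cons -(weight_rev (r :: _)).
by rewrite -(weight_rev (s :: _)) !rev_cons revK.
Qed.

End Values.

(** * $C^\infty$-words and their degree *)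

Lemma iter_derivative_nil (r s k : nat) : iter k (derivative r s) [::] = [::].
Proof. by elim: k => //= k ->. Qed.

Lemma Cinfty_derivative (r s : nat) (w : seq nat) :
  Cinfty r s w <-> word_over r s w /\ Cinfty r s (derivative r s w).
Proof.
split=> [wC|[wA dC] [|k] //]; last by rewrite iterSr.
by split=> [|k]; [exact: (wC 0%N)|rewrite -iterSr].
Qed.

Lemma Cinfty_nil (r s : nat) : Cinfty r s [::].
Proof. by move=> k; rewrite iter_derivative_nil. Qed.

Lemma has_degree_derivative (r s j : nat) (w : seq nat) :
  derivative r s w != [::] ->
  (has_degree r s w j.+1 <->
   word_over r s w /\ has_degree r s (derivative r s w) j).
Proof.
move=> dw0; rewrite /has_degree -!iterSr; split.
  by move=> [_ /Cinfty_derivative[wA dC] ? ?].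
move=> [wA [_ dC ? ?]]; split => //; last exact/Cinfty_derivative.
by apply: contra_neq dw0 => ->.
Qed.

Lemma has_degree_exists (r s : nat) (w : seq nat) : (0 < r)%N -> w != [::] ->
  Cinfty r s w -> exists j, has_degree r s w j.
Proof.
move=> r_gt0; have [n] := ubnP (size w); elim: n w => // n IH w wn wn0 wC.
have [dw0|dw0] := eqVneq (derivative r s w) [::]; first by exists 0%N.
have [wA dC] := (Cinfty_derivative r s w).1 wC.
have [|j dj] := IH (derivative r s w) _ dw0 dC.
  exact: leq_trans (size_derivative r s w r_gt0 wn0) _.
by exists j.+1; apply/has_degree_derivative.
Qed.

(** * The weight meets the requirements on cylinder values *)

Section CylinderValues.
Variables (R : realType) (r s : nat).
Hypotheses (r_gt0 : (0 < r)%N) (lt_rs : (r < s)%N).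

(** Turns the formula in the degree into a one-step recursion for any solution [m]. The test is
    there because [m] is unconstrained on words that are not over [{r, s}]. *)
Lemma cylinder_values_derivative (m : seq nat -> R) (w : seq nat) :
  cylinder_values r s m -> word_over r s w -> derivative r s w != [::] ->
  m w = (if word_over r s (derivative r s w) then m (derivative r s w) else 0)
        / (r + s)%:R.
Proof.
move=> mP wA dw0.
have wn0 : w != [::] by apply: contra_neq dw0 => ->.
have [dC|dC] := pselect (Cinfty r s (derivative r s w)); last first.
  rewrite (cylinder_values_nCinfty mP) //; last by move=> /Cinfty_derivative[].
  case: ifP => [dA|]; last by rewrite mul0r.
  by rewrite (cylinder_values_nCinfty mP) ?mul0r.
have -> : word_over r s (derivative r s w) := dC 0%N.
have [j dj] := has_degree_exists r s _ r_gt0 dw0 dC.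
rewrite (cylinder_values_degree mP dj).
rewrite (@cylinder_values_degree _ _ _ _ mP w j.+1);
  last exact/has_degree_derivative.
by rewrite iterSr exprS invfM mulrA mulrAC.
Qed.

Lemma weight_has_degree (w : seq nat) (j : nat) :
  has_degree r s w j ->
  weight R r s w = weight R r s (iter j (derivative r s) w) * (r + s)%:R ^- j.
Proof.
elim: j w => [|j IH] w wj; first by rewrite expr0 invr1 mulr1.
have dw0 : derivative r s w != [::].
  case: wj => _ _ + _; rewrite iterSr; apply: contra_neq => ->.
  exact: iter_derivative_nil.
have [wA /IH dE] := (has_degree_derivative r s j w dw0).1 wj.
by rewrite weight_derivative // dE iterSr exprS invfM mulrAC mulrA.
Qed.

Lemma weight_nCinfty (w : seq nat) : ~ Cinfty r s w -> weight R r s w = 0.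
Proof.
have [n] := ubnP (size w); elim: n w => // n IH w wn wC.
have [wA|wA] := boolP (word_over r s w); last by rewrite weight_nword.
have wn0 : w != [::] by apply/eqP => w0; apply: wC; rewrite w0;
  exact: Cinfty_nil.
have [dw0|dw0] := eqVneq (derivative r s w) [::].
  by case: wC; apply/Cinfty_derivative; rewrite dw0; split => //;
    exact: Cinfty_nil.
rewrite weight_derivative // IH ?mul0r //.
  exact: leq_trans (size_derivative r s w r_gt0 wn0) _.
by move=> dC; apply/wC/Cinfty_derivative.
Qed.

Lemma sum_letter (F : nat -> R) :
  \sum_(x : letter r s) F (val x) = F r + F s.
Proof.
have rP : r \in [:: r; s] by rewrite !inE eqxx.
have sP : s \in [:: r; s] by rewrite !inE eqxx orbT.
rewrite (bigD1 (SeqSub rP)) //= (bigD1 (SeqSub sP)) /=; last first.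
  by rewrite -val_eqE /= gtn_eqF.
rewrite big1 ?addr0 // => -[x xP]; rewrite -!val_eqE /=.
by move: xP; rewrite !inE => /orP[]/eqP->; rewrite eqxx ?andbF.
Qed.

Lemma sum_tuple0 (F : seq nat -> R) :
  \sum_(t : 0.-tuple (letter r s)) F [seq val x | x <- t] = F [::].
Proof.
rewrite (bigD1 [tuple]) //= big1 ?addr0 // => t.
by rewrite (tuple0 t) => /eqP[].
Qed.

Lemma sum_tupleS (n : nat) (F : seq nat -> R) :
  \sum_(t : n.+1.-tuple (letter r s)) F [seq val x | x <- t] =
  \sum_(t : n.-tuple (letter r s))
    (F (r :: [seq val x | x <- t]) + F (s :: [seq val x | x <- t])).
Proof.
rewrite (reindex (fun p : letter r s * n.-tuple (letter r s) =>
  [tuple of p.1 :: p.2])) /=.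
  rewrite -(pair_big xpredT xpredT (fun x (t : n.-tuple (letter r s)) =>
    F (val x :: [seq val y | y <- t]))) /=.
  rewrite exchange_big /=; apply: eq_bigr => t _.
  by rewrite (sum_letter (fun x => F (x :: [seq val y | y <- t]))).
exists (fun t => (thead t, [tuple of behead t])) => [[x t] _|t _] /=.
  by congr pair; apply/val_inj.
by rewrite [t in RHS]tuple_eta.
Qed.

Lemma sum_tuple1 (F : seq nat -> R) :
  \sum_(t : 1.-tuple (letter r s)) F [seq val x | x <- t] = F [:: r] + F [:: s].
Proof.
exact: etrans (sum_tupleS _ _) (sum_tuple0 (fun t => F (r :: t) + F (s :: t))).
Qed.

Lemma sum_weight (n : nat) :
  \sum_(t : n.-tuple (letter r s)) weight R r s [seq val x | x <- t] = 1.
Proof.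
elim: n => [|n IH]; first by rewrite sum_tuple0 weight_nil.
by rewrite sum_tupleS -[RHS]IH; apply: eq_bigr => t _; rewrite -weight_cons.
Qed.

Lemma cylinder_values_weight : cylinder_values r s (weight R r s).
Proof.
split.
- exact: weight_has_degree.
- by move=> w _ _; exact: weight_nCinfty.
- by move=> w [_ wC _ _]; rewrite weight_mirror //; exact: (wC 0%N).
- by move=> w _; rewrite weight_rev.
- by move=> n _; exact: sum_weight.
Qed.

End CylinderValues.

(** * Uniqueness of the values under additivity to the right *)

Section Uniqueness.
Variables (R : realType) (r s : nat).
Hypotheses (r_gt0 : (0 < r)%N) (lt_rs : (r < s)%N).
Variable m : seq nat -> R.
Hypothesis mP : cylinder_values r s m.
Hypothesis m_rcons : forall w, word_over r s w -> w != [::] ->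
  m w = m (rcons w r) + m (rcons w s).

Local Notation weight := (weight R r s).

Let rA : r \in [:: r; s].
Proof. by rewrite !inE eqxx. Qed.

Let sA : s \in [:: r; s].
Proof. by rewrite !inE eqxx orbT. Qed.

(** Letters are fundamental, so mirror symmetry and the normalisation for [n = 1], which is in range
    as [2 * r + 1 >= 3], give 1/2 each. *)
Lemma cylinder_values_letter (x : nat) :
  x \in [:: r; s] -> m [:: x] = weight [:: x].
Proof.
have mr : m [:: r] = m [:: s].
  rewrite (cylinder_values_mirror mP) /mirror /= ?eqxx //.
  have d0 : derivative r s [:: r] = [::].
    by rewrite derivativeE /=; case: ifP => //; lia.
  split => //.
  by apply/Cinfty_derivative; rewrite d0 /= rA; split => //; exact: Cinfty_nil.
have : m [:: r] + m [:: s] = 1.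
  have := @cylinder_values_sum _ _ _ _ mP 1.
  rewrite sum_tuple1 //.
  by apply; rewrite leq_max; lia.
by move=> + xA; rewrite weight_letter // => + ; move: xA mr; rewrite !inE
  => /orP[]/eqP-> -> ?; lra.
Qed.

(** Both functions obey the same one-step recursion; if the derivative leaves the alphabet, both
    vanish. *)
Lemma eq_weight_derivative (w : seq nat) :
  word_over r s w -> derivative r s w != [::] ->
  (word_over r s (derivative r s w) ->
     m (derivative r s w) = weight (derivative r s w)) ->
  m w = weight w.
Proof.
move=> wA dw0 dE; have wP := cylinder_values_weight R r s r_gt0 lt_rs.
rewrite !(@cylinder_values_derivative _ r s r_gt0 _ w) //.
by case: ifP => // dA; rewrite dE.
Qed.

(** An appended letter either lengthens the last run or opens a new one. The run lengths come from
    the statement about prepending, applied to [rev w]. *)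
Lemma eq_weight_extend (w : seq nat) (L : seq nat) (l : nat) :
  word_over r s w -> run_lengths w = rcons L l ->
  (forall v, word_over r s v -> run_lengths v = rcons L l.+1 ->
     m v = weight v) ->
  (forall v, word_over r s v -> run_lengths v = rcons (rcons L l) 1 ->
     m v = weight v) ->
  m w = weight w.
Proof.
move=> wA wE h1 h2.
have wn0 : w != [::] by rewrite -run_lengths_nil wE; case: (L).
have [||x [y [xy Ex Ey]]] := run_lengths_extend r s lt_rs (rev w).
- by rewrite word_over_rev.
- by rewrite -size_eq0 size_rev size_eq0.
have sum_xy (F : nat -> R) : F r + F s = F x + F y.
  transitivity (\sum_(z <- [:: r; s]) F z);
    first by rewrite 2!big_cons big_nil addr0.
  by rewrite -(perm_big _ xy) 2!big_cons big_nil /= addr0.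
have [xA yA] : x \in [:: r; s] /\ y \in [:: r; s].
  by rewrite -!(perm_mem xy) !inE !eqxx orbT.
rewrite m_rcons // weight_rcons // (sum_xy (fun z => m (rcons w z))).
rewrite (sum_xy (fun z => weight (rcons w z))).
have wE' : rev (run_lengths w) = l :: rev L by rewrite wE rev_rcons.
congr (_ + _).
  apply: h1; first by rewrite /word_over all_rcons xA.
  apply: (can_inj revK); rewrite -run_lengths_rev rev_rcons Ex
    run_lengths_rev wE'.
  by rewrite rev_rcons.
apply: h2; first by rewrite /word_over all_rcons yA.
apply: (can_inj revK); rewrite -run_lengths_rev rev_rcons Ey
  run_lengths_rev wE'.
by rewrite !rev_rcons.
Qed.

Lemma end_run_small (l : nat) : (l <= r)%N -> end_run r s l = [::].
Proof. by rewrite /end_run => ->. Qed.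

Lemma end_run_large (l : nat) : (r < l <= s)%N -> end_run r s l = [:: s].
Proof. by rewrite /end_run => /andP[rl ->]; rewrite leqNgt rl. Qed.

(** The last run grows until its length is [r + 1], where the derivative becomes [[:: s]]. Opening a
    third run makes [l'] an inner run, with derivative [[:: l']]. *)
Lemma eq_weight_two_runs (w : seq nat) (l l' : nat) : word_over r s w ->
  run_lengths w = [:: l; l'] -> (l <= r)%N -> (l' <= r)%N -> m w = weight w.
Proof.
have [n] := ubnP (r - l'); elim: n w l' => // n IH w l' nr wA wE lr l'r.
apply: (@eq_weight_extend w [:: l] l' wA wE) => v vA vE.
  have [l'r'|l'r'] := ltnP l' r; first by apply: (IH v l'.+1 _ vA vE); lia.
  have dE : derivative r s v = [:: s].
    by rewrite derivativeE vE /= end_run_small // end_run_large //; lia.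
  by apply: eq_weight_derivative; rewrite // dE // cylinder_values_letter.
have dE : derivative r s v = [:: l'].
  by rewrite derivativeE vE /= !end_run_small.
apply: eq_weight_derivative; rewrite // dE //= andbT => l'A.
exact: cylinder_values_letter.
Qed.

(** The run grows until its length is [s], where the derivative is [[:: s]]. Opening a new run leads
    to the preceding case if [l <= r], and to derivative [[:: s]] otherwise. *)
Lemma eq_weight_one_run (w : seq nat) (l : nat) : word_over r s w ->
  run_lengths w = [:: l] -> (l < s)%N -> m w = weight w.
Proof.
have [n] := ubnP (s - l); elim: n w l => // n IH w l nr wA wE ls.
apply: (@eq_weight_extend w [::] l wA wE) => v vA vE.
  have [ls'|ls'] := ltnP l.+1 s; first by apply: (IH v l.+1 _ vA vE); lia.
  have dE : derivative r s v = [:: s].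
    by rewrite derivativeE vE /= ltnNge ls' /= end_run_large //; lia.
  by apply: eq_weight_derivative; rewrite // dE // cylinder_values_letter.
have [lr|rl] := leqP l r; first exact: (eq_weight_two_runs v l 1 vA vE).
have dE : derivative r s v = [:: s].
  by rewrite derivativeE vE /= (end_run_small 1) // end_run_large //; lia.
by apply: eq_weight_derivative; rewrite // dE // cylinder_values_letter.
Qed.

Lemma cylinder_values_unique (w : seq nat) :
  word_over r s w -> w != [::] -> m w = weight w.
Proof.
have [n] := ubnP (size w); elim: n w => // n IH w wn wA wn0.
have [dw0|dw0] := eqVneq (derivative r s w) [::]; last first.
  apply: eq_weight_derivative => // dA; apply: IH => //.
  exact: leq_trans (size_derivative r s w r_gt0 wn0) _.
move: dw0; rewrite derivativeE.
have := run_lengths_nil w; case wE: (run_lengths w) => [|l L];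
  first by rewrite (negPf wn0).
case/lastP: L wE => [|L l'] wE _.
  rewrite /=; case: ifP => [ls _|ls].
    exact: (eq_weight_one_run w l wA wE ls).
  by rewrite /end_run; do 2?case: ifP => //; lia.
have small k : end_run r s k = [::] -> (k <= r)%N.
  by rewrite /end_run; case: ifP => // _; case: ifP.
(* With at least two runs, an empty derivative means that there are no inner runs and that both end
   runs are deleted. *)
rewrite derivative_of_runs_rcons => /eqP.
rewrite -!size_eq0 !size_cat !addn_eq0 !size_eq0.
case/and3P => /eqP/small lr /eqP L0 /eqP/small l'r.
by apply: (eq_weight_two_runs w l l') => //; rewrite wE L0.
Qed.

End Uniqueness.

(** * Cylinders as generators of the Borel sets *)

Section Cylinders.
Variables (r s : nat).

Lemma cylinder_nil : cylinder r s [::] = setT.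
Proof. by rewrite -subTset => z _ i. Qed.

Lemma cylinder_rcons (w : seq nat) (c : nat) :
  cylinder r s (rcons w c) =
  cylinder r s w `&` [set z | val (z (size w)) = c].
Proof.
apply/seteqP; split=> z; rewrite /cylinder /= size_rcons.
  move=> zw; split=> [i iw|]; last by rewrite zw // nth_rcons ltnn eqxx.
  by rewrite zw ?nth_rcons ?iw // ltnS ltnW.
move=> [zw zc] i; rewrite ltnS nth_rcons leq_eqVlt.
by case: ltngtP => //= [iw _|->]; [exact: zw|].
Qed.

Lemma cylinder_prefix (z : infword r s) (n : nat) (y : infword r s) :
  cylinder r s (mkseq (fun i => val (z i)) n) y <->
  forall i, (i < n)%N -> y i = z i.
Proof.
rewrite /cylinder /= size_mkseq; split=> yz i lt_in.
  by apply: val_inj; have := yz i lt_in; rewrite nth_mkseq.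
by rewrite nth_mkseq // yz.
Qed.

Lemma cylinder_nword (w : seq nat) :
  ~~ word_over r s w -> cylinder r s w = set0.
Proof.
move=> /allPn[x xw xA]; rewrite -subset0 => z zw.
case/negP: xA; rewrite -(nth_index 0%N xw) -zw ?index_mem //.
exact: valP.
Qed.

(** Two cylinders are nested or disjoint; the empty set counts as the cylinder of a word with a
    foreign letter. This is the stability under intersection that uniqueness of measures needs. *)
Lemma cylinderI (u v : seq nat) :
  exists w, cylinder r s u `&` cylinder r s v = cylinder r s w.
Proof.
wlog uv : u v / (size u <= size v)%N => [H|].
  by have [|/ltnW] := leqP (size u) (size v); [|rewrite setIC]; apply: H.
have [uv0|/set0P[z [zu zv]]] := eqVneq (cylinder r s u `&` cylinder r s v) set0.
  (* A letter larger than both [r] and [s]. *)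
  exists [:: (maxn r s).+1]; rewrite uv0 cylinder_nword // /word_over /= !inE.
  by rewrite !gtn_eqF // ltnS ?leq_maxl ?leq_maxr.
exists v; apply/setIidr => y yv i iu.
by rewrite yv ?(leq_trans iu) // -zu // zv // (leq_trans iu).
Qed.

Lemma open_cylinder (w : seq nat) : open (cylinder r s w : set (infword r s)).
Proof.
elim/last_ind: w => [|w c IH]; first by rewrite cylinder_nil; exact: openT.
rewrite cylinder_rcons; apply: openI => //.
pose K := (fun _ => discrete_topology (letter r s)) : nat -> topologicalType.
apply: (@open_comp (prod_topology K) (K (size w)) (@proj nat K (size w))
  [set x | val x = c]).
  by move=> z _; exact: proj_continuous.
exact: discrete_open.
Qed.

Lemma nbhs_cylinder (z : infword r s) (U : set (infword r s)) : nbhs z U ->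
  exists n, cylinder r s (mkseq (fun i => val (z i)) n) `<=` U.
Proof.
pose F := filter_from setT (fun n => cylinder r s (mkseq (fun i => val (z i)) n)
   : set (infword r s)).
have FF : Filter F.
  apply: filter_from_filter; first by exists 0%N.
  move=> i j _ _; exists (maxn i j) => // y /cylinder_prefix yz.
  by split; apply/cylinder_prefix => k ki; apply: yz; rewrite leq_max ki ?orbT.
suff Fz : F --> z by move=> /Fz[n _ nU]; exists n.
(* The product topology is a supremum over the coordinates, so convergence is checked at one
   coordinate [i], which a prefix of length [i + 1] fixes. *)
apply/cvg_sup => i U' [/= _ [[V /= oV <- /= Vz]]] /filterS; apply.
by exists i.+1 => // y /cylinder_prefix yz /=; rewrite yz.
Qed.

Lemma open_bigcup_cylinder (U : set (infword r s)) : open U ->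
  U = \bigcup_(w in [set w | cylinder r s w `<=` U]) cylinder r s w.
Proof.
move=> oU; apply/seteqP; split=> [z Uz|z [w wU zw]]; last exact: wU.
have [n nU] := nbhs_cylinder z U (open_nbhs_nbhs (conj oU Uz)).
by exists (mkseq (fun i => val (z i)) n) => //; exact/cylinder_prefix.
Qed.

Lemma measurable_cylinder (w : seq nat) : measurable (cylinder r s w).
Proof. by apply: sub_sigma_algebra; exact: open_cylinder. Qed.

(** An open set is a union of cylinders, and a countable one since there are countably many finite
    words. *)
Lemma measurable_borel_infword :
  @measurable _ (borel_infword r s) = <<s range (cylinder r s) >>.
Proof.
apply/seteqP; split; apply: smallest_sub.
- exact: smallest_sigma_algebra.
- move=> U oU; rewrite (open_bigcup_cylinder U oU).
  rewrite bigcup_mkcond.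
  pose T := g_sigma_algebraType (range (cylinder r s)).
  apply: (@countable_bigcupT_measurable _ T) => [|w]; first exact: countableP.
  case: ifP => _; last exact: (@measurable0 _ T).
  by apply: sub_sigma_algebra; exists w.
- exact: smallest_sigma_algebra.
- by move=> _ [w _ <-]; exact: measurable_cylinder.
Qed.

Lemma measurable_fun_infword d (T : measurableType d)
    (f : T -> borel_infword r s) :
  (forall w, measurable (f @^-1` cylinder r s w)) -> measurable_fun setT f.
Proof.
move=> mf; apply: (@measurability _ _ T (borel_infword r s) setT f
  (range (cylinder r s))).
  exact: measurable_borel_infword.
move=> _ [_ [w _ <-] <-].
by rewrite setTI.
Qed.

(** Cylinders are stable under intersection and generate the Borel sets; the constant sequence at
    the cylinder of the empty word is the required cover by sets of finite measure. *)
Lemma infword_measure_unique (R : realType)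
    (P Q : {measure set (borel_infword r s) -> \bar R}) :
  (P setT < +oo)%E -> (forall w, P (cylinder r s w) = Q (cylinder r s w)) ->
  forall B, measurable B -> P B = Q B.
Proof.
move=> Pfin PQ B; rewrite measurable_borel_infword.
apply: (@g_sigma_algebra_measure_unique _ _ _ (range (cylinder r s)) _
  (fun=> cylinder r s [::])).
- by move=> _ [w _ <-]; exact: measurable_cylinder.
- by move=> _; exists [::].
- by rewrite cylinder_nil bigcup_const.
- by move=> _ _ [u _ <-] [v _ <-]; have [w ->] := cylinderI u v; exists w.
- by move=> _ [w _ <-]; exact: PQ.
- by move=> _; rewrite cylinder_nil.
Qed.

End Cylinders.

(** * Extension to a measure by coding real numbers *)

Section Extension.
Variables (R : realType) (r s : nat).
Hypothesis neq_rs : r != s.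
Variable m : seq nat -> R.
Hypotheses (m_ge0 : forall w, 0 <= m w) (m_nil : m [::] = 1).
Hypothesis m_rcons : forall w, word_over r s w ->
  m w = m (rcons w r) + m (rcons w s).

Let rA : r \in [:: r; s].
Proof. by rewrite !inE eqxx. Qed.

Let sA : s \in [:: r; s].
Proof. by rewrite !inE eqxx orbT. Qed.

(* The intervals of the words of a given length are ordered lexicographically,
   with r before s. *)
Definition left_end (w : seq nat) : R :=
  \sum_(0 <= i < size w | nth 0%N w i == s) m (rcons (take i w) r).

Definition next_letter (w : seq nat) (x : R) : letter r s :=
  if x < left_end w + m (rcons w r) then SeqSub rA else SeqSub sA.

Fixpoint coding_prefix (n : nat) (x : R) : seq nat :=
  if n is k.+1 then
    let w := coding_prefix k x in rcons w (val (next_letter w x))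
  else [::].

Definition coding (x : R) : borel_infword r s :=
  fun n => next_letter (coding_prefix n x) x.

Lemma left_end_rcons (w : seq nat) (c : nat) :
  left_end (rcons w c) = left_end w + (if c == s then m (rcons w r) else 0).
Proof.
rewrite /left_end size_rcons big_mkcond big_nat_recr //= -big_mkcond /=.
rewrite nth_rcons ltnn eqxx -cats1 take_size_cat //; congr (_ + _).
rewrite big_nat_cond [RHS]big_nat_cond;
  apply: eq_big => [i|i /andP[/andP[_ iw] _]].
  by rewrite nth_cat; case: ltnP => //; rewrite andbF.
by rewrite takel_cat // ltnW.
Qed.

Lemma coding_cylinder (w : seq nat) (x : R) :
  cylinder r s w (coding x) <-> coding_prefix (size w) x = w.
Proof.
elim/last_ind: w => [|w c IH]; first by rewrite cylinder_nil.
rewrite cylinder_rcons size_rcons /=; split.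
  by move=> [/IH wE /=]; rewrite /coding wE => ->.
by move=> /rcons_inj[/[dup] /IH xw wE cE]; split => //=;
  rewrite /coding wE -cE wE.
Qed.

(** If the code of [x] starts with [w], its next letter is decided by the threshold of [w]. *)
Lemma coding_cylinder_rcons (w : seq nat) (c : nat) :
  coding @^-1` cylinder r s (rcons w c) =
  coding @^-1` cylinder r s w `&` [set x | val (next_letter w x) = c].
Proof.
rewrite cylinder_rcons preimage_setI.
by apply/seteqP; split=> x [/= /coding_cylinder xw]; rewrite /coding xw;
  split => //=; apply/coding_cylinder.
Qed.

Lemma measurable_next_letter (w : seq nat) (c : nat) :
  measurable [set x : measurableTypeR R | val (next_letter w x) = c].
Proof.
set t := left_end w + m (rcons w r).
rewrite [X in measurable X](_ : _ =
    (if r == c then [set` `]-oo, t[ ] else set0) `|`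
    (if s == c then [set` `[t, +oo[ ] else set0)).
  by apply: measurableU; case: ifP => // _; exact: measurable_itv.
apply/seteqP; split=> x /=; rewrite /next_letter -/t; case: ltP => xt /=.
- by move=> ->; left; rewrite eqxx /= in_itv.
- by move=> ->; right; rewrite eqxx /= in_itv /= xt.
- case; case: ifP => // /eqP // _; rewrite /= in_itv /= andbT => tx.
  by move: xt; rewrite ltNge tx.
- case; case: ifP => // /eqP // _; rewrite /= in_itv /= => tx.
  by move: xt; rewrite leNgt tx.
Qed.

Lemma measurable_coding :
  measurable_fun setT (coding : measurableTypeR R -> borel_infword r s).
Proof.
apply: measurable_fun_infword; elim/last_ind => [|w c IH].
  by rewrite cylinder_nil preimage_setT; exact: measurableT.
by rewrite coding_cylinder_rcons; apply: measurableI => //;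
  exact: measurable_next_letter.
Qed.

(** Every real has a code, hence the restriction to [[0, 1[], the interval of the empty word. At
    each letter the threshold cuts the interval of [w] into those of [rcons w r] and [rcons w s]. *)
Lemma coding_cylinderE (w : seq nat) : word_over r s w ->
  coding @^-1` cylinder r s w `&` `[0, 1[ =
  [set` `[left_end w, left_end w + m w[ ].
Proof.
elim/last_ind: w => [_|w c IH].
  by rewrite cylinder_nil preimage_setT setTI m_nil /left_end big_geq ?add0r.
rewrite /word_over all_rcons => /andP[cA wA].
rewrite coding_cylinder_rcons setIAC IH // left_end_rcons.
have mw := m_rcons w wA; have mr := m_ge0 (rcons w r).
have ms := m_ge0 (rcons w s).
move: cA; rewrite !inE => /orP[]/eqP->.
  rewrite (negPf neq_rs) addr0; apply/seteqP; split=> x /=.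
    move=> []; rewrite !in_itv /= /next_letter => /andP[-> _].
    case: ltP => //= _ sr.
    by move: neq_rs; rewrite sr eqxx.
  rewrite !in_itv /= /next_letter => /andP[-> xt]; rewrite xt /=; split => //.
  by apply: (lt_le_trans xt); rewrite mw; lra.
rewrite eqxx; apply/seteqP; split=> x /=.
  move=> []; rewrite !in_itv /= /next_letter => /andP[_ xm].
  case: ltP => //= xt.
    by move=> rs; move: neq_rs; rewrite rs eqxx.
  by move=> _; apply: (lt_le_trans xm); rewrite mw; lra.
rewrite !in_itv /= /next_letter => /andP[xt xm].
have -> /= : (x < left_end w + m (rcons w r)) = false by rewrite ltNge xt.
split => //.
by apply/andP; split; lra.
Qed.

Lemma cylinder_measure_exists :
  exists P : {measure set (borel_infword r s) -> \bar R},
    forall w, word_over r s w -> P (cylinder r s w) = (m w)%:E.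
Proof.
have mI : measurable (`[0, 1[ : set (measurableTypeR R)).
  exact: measurable_itv.
pose P0 : {measure set (measurableTypeR R) -> \bar R} :=
  mrestr lebesgue_measure mI.
pose P : {measure set (borel_infword r s) -> \bar R} :=
  measure_function_pushforward__canonical__measure_function_Measure P0
    measurable_coding.
exists P => w wA; rewrite /P /= /pushforward /P0 /= /mrestr coding_cylinderE //.
rewrite lebesgue_measure_itv /= lte_fin ltrDl; have := m_ge0 w.
(* The length formula for intervals distinguishes the empty interval, which occurs when
   [m w = 0]. *)
rewrite le_eqVlt => /orP[/eqP<-|->]; first by rewrite ltxx.
by rewrite -EFinB addrAC subrr add0r.
Qed.

End Extension.

(** * Additivity on cylinders and shift invariance *)

Section ShiftInvariance.
Variables (R : realType) (r s : nat).
Hypothesis neq_rs : r != s.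

Lemma shift_cylinder (w : seq nat) :
  shift_infword r s @^-1` cylinder r s w =
  cylinder r s (r :: w) `|` cylinder r s (s :: w).
Proof.
apply/seteqP; split=> z.
  move=> zw; have := valP (z 0%N); rewrite !inE => /orP[]/eqP z0; [left|right];
  by case=> [|i] //= iw; exact: zw.
by case=> zw i iw; exact: (zw i.+1).
Qed.

(** The distinguishing position [i] is 0 for preimages under the shift and [size w] for splitting on
    the right. *)
Lemma measure_cylinderU (P : {measure set (borel_infword r s) -> \bar R})
    (u v : seq nat) i :
  (i < size u)%N -> (i < size v)%N -> nth 0%N u i != nth 0%N v i ->
  P (cylinder r s u `|` cylinder r s v) =
  (P (cylinder r s u) + P (cylinder r s v))%E.
Proof.
move=> iu iv uv; rewrite measureU //; try exact: measurable_cylinder.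
apply/seteqP; split=> z // [zu zv].
by move: uv; rewrite -zu // -zv // eqxx.
Qed.

Lemma cylinder_split (w : seq nat) :
  cylinder r s w = cylinder r s (rcons w r) `|` cylinder r s (rcons w s).
Proof.
rewrite !cylinder_rcons -setIUr; apply/esym/setIidl => z _ /=.
by have := valP (z (size w)); rewrite !inE => /orP[]/eqP; [left|right].
Qed.

Lemma measure_cylinder_rcons (P : {measure set (borel_infword r s) -> \bar R})
    (w : seq nat) :
  P (cylinder r s w) =
  (P (cylinder r s (rcons w r)) + P (cylinder r s (rcons w s)))%E.
Proof.
rewrite {1}cylinder_split (@measure_cylinderU _ _ _ (size w)) ?size_rcons //.
by rewrite !nth_rcons ltnn eqxx.
Qed.

Lemma measurable_shift : measurable_fun setT (shift_infword r s).
Proof.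
apply: measurable_fun_infword => w; rewrite shift_cylinder.
by apply: measurableU; exact: measurable_cylinder.
Qed.

(** The hypothesis says that [P] and its image under the shift agree on cylinders, so they agree on
    all Borel sets. *)
Lemma shift_invariant_cylinders
    (P : {measure set (borel_infword r s) -> \bar R}) :
  (P setT < +oo)%E ->
  (forall w, word_over r s w ->
    P (cylinder r s w) =
      P (cylinder r s (r :: w)) + P (cylinder r s (s :: w)))%E ->
  shift_invariant P.
Proof.
move=> Pfin Psum B mB.
pose Q : {measure set (borel_infword r s) -> \bar R} :=
  measure_function_pushforward__canonical__measure_function_Measure P
    measurable_shift.
apply/esym; apply: (@infword_measure_unique _ _ _ P Q) => // w.
rewrite /Q /= /pushforward shift_cylinder.
have [wA|wA] := boolP (word_over r s w).
  by rewrite Psum // (@measure_cylinderU _ _ _ 0%N).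
have cA c : ~~ word_over r s (c :: w) by apply: contra wA => /andP[].
by rewrite !cylinder_nword // setU0.
Qed.

End ShiftInvariance.

Theorem mainTheorem2 (R : realType) (r s : nat)
    (r_gt0 : (0 < r)%N) (lt_rs : (r < s)%N) :
  exists mu : seq nat -> R,
    [/\ cylinder_values r s mu,
        (exists P : {measure set (borel_infword r s) -> \bar R},
          [/\ extends mu P, mirror_invariant P, reversal_invariant P
            & shift_invariant P])
      & (forall mu' : seq nat -> R, cylinder_values r s mu' ->
          (exists P' : {measure set (borel_infword r s) -> \bar R},
            extends mu' P') ->
          forall w, word_over r s w -> w != [::] -> mu' w = mu w)].
Proof.
have neq_rs : r != s by rewrite ltn_eqF.
exists (weight R r s); split.
- exact: cylinder_values_weight.
- have [|||P PE] := @cylinder_measure_exists R r s neq_rs (weight R r s).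
  + exact: weight_ge0.
  + exact: weight_nil.
  + by move=> w _; exact: weight_rcons.
  exists P; split.
  + by move=> w wA _; exact: PE.
  + by move=> w wA; rewrite !PE ?word_over_mirror // weight_mirror.
  + by move=> w wA; rewrite !PE ?word_over_rev // weight_rev.
  + apply: shift_invariant_cylinders => // [|w wA].
      (* The whole space is the cylinder of the empty word, of weight 1. *)
      by rewrite -(cylinder_nil r s) PE // ltry.
    have cA c : c \in [:: r; s] -> word_over r s (c :: w) by move=> ?;
      apply/andP.
    by rewrite !PE ?cA ?inE ?eqxx ?orbT // -EFinD -weight_cons.
(* The values inherit additivity to the right from the measure that they extend to. *)
- move=> m mP [P PE]; apply: cylinder_values_unique => // w wA wn0.
  have rcA c : c \in [:: r; s] -> word_over r s (rcons w c).
    by move=> ?; rewrite /word_over all_rcons; apply/andP.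
  have rc0 c : rcons w c != [::] by rewrite -size_eq0 size_rcons.
  apply: EFin_inj; rewrite EFinD -!PE ?rcA ?inE ?eqxx ?orbT //.
  exact: measure_cylinder_rcons.
Qed.
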